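(* Let $d\geqslant 1$ be an integer and let $b$ be an integer greater than $1$. There exists a constant $c>0$, depending only on $b$ and $d$, such that the following holds. Let $N$ be a positive integer, let $\nu$ be the integer such that $b^{\nu-2}\leqslant N<b^{\nu-1}$, and let $M=b^{\nu+\tau}$ for an integer $\tau\geqslant 1$. Then for every finite sequence $\mathcal P_N=\{p_n\}_{n=1}^N$ in $[0,1)^d$, \[ \left(\frac{1}{M^{d}}\sum_{j_{1},\ldots,j_{d}=1}^{M}\left| \mathscr{D}\left(A\Big(\frac{j_{1}}{M},\ldots,\frac{j_{d}}{M}\Big),\mathcal{P}_{N}\right)\right|^{2}\right)^{\frac{1}{2}}\geqslant c\,\log^{\frac{d-1}{2}}(N). \] In particular, there exist $j_1,\ldots,j_d\in\{1,\ldots,M\}$ such that \[ \left|\mathscr{D}\left(A\Big(\frac{j_1}{M},\ldots,\frac{j_d}{M}\Big),\mathcal P_N\right)\right|\geqslant c\,\log^{\frac{d-1}{2}}(N). \] Moreover, when $d=2$ there exists a constant $\widetilde c>0$, depending only on $b$, such that for all $N,\nu,\tau,M$ and $\mathcal P_N$ as just described there exist $j_1,j_2\in\{1,\ldots,M\}$ such that the stronger estimate \[ \left|\mathscr{D}\left(A\Big(\frac{j_1}{M},\frac{j_2}{M}\Big),\mathcal P_N\right)\right|\geqslant \widetilde c\,\log(N) \] holds.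
   Context: For $x=(x_1,\ldots,x_d)\in(0,1]^d$ let $A(x)=[0,x_1)\times\cdots\times[0,x_d)$ (anchored box). For a finite sequence $\mathcal P_N=\{p_n\}_{n=1}^N$ of points in $[0,1)^d$ (repetitions allowed), the discrepancy is \[ \mathscr D(A(x),\mathcal P_N)=\sum_{n=1}^N\chi_{A(x)}(p_n)-N x_1\cdots x_d, \] where $\chi_E$ denotes the characteristic function of $E$. Here $\log^{a}(N)=(\log N)^a$. *)

(* Defs.v *)
From HB Require Import structures.
From mathcomp Require Import all_boot all_order all_algebra.
From mathcomp Require Import all_classical all_reals all_analysis.

Set Implicit Arguments.
Unset Strict Implicit.
Unset Printing Implicit Defensive.

Import Order.TTheory GRing.Theory Num.Theory.
Local Open Scope classical_set_scope.
Local Open Scope ring_scope.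

Definition unit_cube (R : realType) (d : nat) : set 'rV[R]_d :=
  [set y | forall i, 0 <= y 0 i < 1].

Definition anchored_box (R : realType) (d : nat) (x : 'rV[R]_d) :
    set 'rV[R]_d :=
  [set y | forall i, 0 <= y 0 i < x 0 i].

Definition discrepancy (R : realType) (d N : nat) (x : 'rV[R]_d)
    (P : 'I_N -> 'rV[R]_d) : R :=
  \sum_(n < N) \1_(anchored_box x) (P n) - N%:R * \prod_(i < d) x 0 i.

(* The index [j i : 'I_M] ranges over 0, ..., M - 1 and stands for the
   one-based index [(j i).+1], so coordinates range over 1/M, ..., M/M. *)
Definition grid_point (R : realType) (d M : nat) (j : {ffun 'I_d -> 'I_M}) :
    'rV[R]_d :=
  \row_i ((j i).+1%:R / M%:R).
Arguments grid_point R {d M} j.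

(* Main.v *)
Require Import Defs.
From HB Require Import structures.
From mathcomp Require Import all_boot all_order all_algebra.
From mathcomp Require Import all_classical all_reals all_analysis.
From mathcomp Require Import zify ring lra.

Set Implicit Arguments.
Unset Strict Implicit.
Unset Printing Implicit Defensive.

Import Order.TTheory GRing.Theory Num.Theory.
Local Open Scope classical_set_scope.
Local Open Scope ring_scope.

(** Roth's orthogonal function method, carried out on the grid itself. Since
    [p < (k + 1) / M] iff [floor (M p) <= k], the points may be replaced by
    their integer cells and the discrepancy becomes a function on
    [{0, ..., M - 1}^d]. With [b^n] comparable to [N] and at least [2 N], for
    every level vector [r] of sum [n] at least half of the [b]-adic boxes of
    levels [r] contain no point; the sum [f_r] of the Haar functions of these
    empty boxes only sees the linear part of the discrepancy, so its
    correlation with [D] is bounded below by a constant [c0]. The [f_r] are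
    bounded by 1 and orthogonal. Expanding [sum (D - t F)^2 >= 0] for
    [F = sum_r f_r] over about [n^(d-1)] vectors [r] gives the [L^2] bound.
    For [d = 2] the test function is Halasz' Riesz product
    [prod_l (1 + g f_(l, n - l)) - 1], of [L^1] norm at most 2: in its expansion
    the terms linear in [g] dominate, and a product with extreme levels
    [l < m] is a combination of Haar functions of empty boxes of levels
    [(m, n - l)], hence contributes only [O ((3/4)^(m - l))]. *)

(** * Cells and Haar functions in one variable *)

Section Cells.
Context (R : realType) (b : nat).
Hypothesis hb : (1 < b)%N.

(** The index of the [b]-adic interval of level [r], made of [b ^ (K - r)] grid points, that
    contains [k]. Truncated subtraction makes this meaningful for [r <= K]. *)
Definition cell (K r k : nat) : nat := k %/ b ^ (K - r).

(** [cell K r.+1 k %% b] is the rank of [k] among the [b] children of its level [r] interval: the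
    value is 1 on the first child, -1 on the second, 0 on the others. There is no [L^2]
    normalisation, so the bound is 1 at every level. *)
Definition haar (K r k : nat) : R :=
  (cell K r.+1 k %% b == 0)%N%:R - (cell K r.+1 k %% b == 1)%N%:R.

(** An indicator-weighted sum over the whole range, so that a product of averages over the
    coordinates expands by [bigA_distr_bigA]. *)
Definition cell_avg (K w : nat) (g : nat -> R) (k0 : nat) : R :=
  (\sum_(k < b ^ K) (cell K w k == cell K w k0)%:R * g k) / b%:R ^+ (K - w).

Lemma expb_gt0 e : (0 < b ^ e)%N.
Proof. by rewrite expn_gt0 (ltnW hb). Qed.

Lemma b_gt0 : 0 < b%:R :> R.
Proof. by rewrite ltr0n ltnW. Qed.

Lemma cell_avgE K w g k0 : (w <= K)%N -> (k0 < b ^ K)%N ->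
  cell_avg K w g k0 =
  (\sum_(t < b ^ (K - w)) g (cell K w k0 * b ^ (K - w) + t)%N)
    / b%:R ^+ (K - w).
Proof.
move=> wK k0K; congr (_ / _); set W := (b ^ (K - w))%N; set c := cell K w k0.
have W0 : (0 < W)%N by exact: expb_gt0.
have cW : (c * W + W <= b ^ K)%N.
  rewrite -mulSnr -(subnK wK) expnD mulnC -/W leq_mul2l ltn_divLR //.
  by rewrite -/W mulnC -expnD subnK // k0K orbT.
rewrite -(big_mkord xpredT (fun k => (cell K w k == c)%:R * g k)).
rewrite (@big_cat_nat _ _ _ (c * W)%N) //=; last by lia.
rewrite (@big_cat_nat _ _ _ (c * W + W)%N (c * W)%N) //=; last by lia.
rewrite [X in X + _]big_nat [X in X + _]big1 ?add0r; last first.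
  move=> i; rewrite leq0n /= => ic; case: eqP => [e|_]; last by rewrite mul0r.
  by move: ic; rewrite -e /cell ltnNge leq_divM.
rewrite [X in _ + X]big_nat [X in _ + X]big1 ?addr0; last first.
  move=> i /andP[ic _]; case: eqP => [e|_]; last by rewrite mul0r.
  have := @ltn_ceil i W W0; move: e; rewrite /cell -/W => ->; lia.
rewrite -{1}[(c * W)%N]add0n big_addn addKn big_mkord.
apply: eq_bigr => t _; rewrite addnC /cell divnMDl // divn_small // addn0.
by rewrite eqxx mul1r.
Qed.

Lemma cell_sum1 K w k0 : (w <= K)%N -> (k0 < b ^ K)%N ->
  \sum_(k < b ^ K) (cell K w k == cell K w k0)%:R = b%:R ^+ (K - w) :> R.
Proof.
move=> wK k0K; have := cell_avgE (fun=> 1) wK k0K.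
rewrite sumr_const card_ord natrX divff ?expf_neq0 ?gt_eqF ?b_gt0//.
move/divr1_eq => <-; by apply: eq_bigr => k _; rewrite mulr1.
Qed.

Lemma sum_ord_mul (A W : nat) (F : nat -> R) :
  \sum_(k < A * W) F k = \sum_(c < A) \sum_(t < W) F (c * W + t)%N.
Proof.
elim: A => [|A IH]; first by rewrite mul0n !big_ord0.
by rewrite big_ord_recr /= -IH mulSnr big_split_ord.
Qed.

(** Only the first two children, of length [L], carry weight; their points at the same offset [s]
    are paired. *)
Lemma cell_avg_haar K r g k0 : (r < K)%N -> (k0 < b ^ K)%N ->
  let L := (b ^ (K - r.+1))%N in let a := (cell K r k0 * b ^ (K - r))%N in
  cell_avg K r (fun k => haar K r k * g k) k0 =
  (\sum_(s < L) (g (a + s)%N - g (a + L + s)%N)) / b%:R ^+ (K - r).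
Proof.
move=> rK k0K L a; rewrite (cell_avgE _ (ltnW rK) k0K).
f_equal.
have EL : (b ^ (K - r) = b * L)%N by rewrite -expnS subnSK.
have L0 : (0 < L)%N by exact: expb_gt0.
rewrite -/a -(big_mkord xpredT (fun t => haar K r (a + t)%N * g (a + t)%N)).
rewrite EL big_mkord (sum_ord_mul _ _ (fun t => haar K r (a + t)%N * g (a + t)%N)).
have hE e s : (e < b)%N -> (s < L)%N ->
    haar K r (a + (e * L + s)) = (e == 0)%N%:R - (e == 1)%N%:R.
  move=> eb sL; rewrite /haar /cell -/L /a EL.
  rewrite mulnA addnA -mulnDl divnMDl // divn_small // addn0.
  by rewrite modnMDl modn_small.
rewrite -(big_mkord xpredT (fun e => \sum_(t < L) haar K r (a + (e * L + t))%N
  * g (a + (e * L + t))%N)).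
rewrite big_ltn ?(ltnW hb)// big_ltn // [X in _ + (_ + X)]big_nat.
rewrite [X in _ + (_ + X)]big1 ?addr0; last first.
  move=> e /andP[e1 eb]; rewrite big1// => s _; rewrite hE //.
  by case: e e1 {eb} => [|[|e]] //= _; rewrite subrr mul0r.
rewrite -big_split /=; apply: eq_bigr => s _.
rewrite !hE ?(ltnW hb)//=.
by rewrite mul0n add0n mul1n subr0 sub0r mul1r mulN1r addnA.
Qed.

Lemma cell_avg_haar0 K r k0 : (r < K)%N -> (k0 < b ^ K)%N ->
  cell_avg K r (haar K r) k0 = 0.
Proof.
move=> rK k0K; have := cell_avg_haar (fun=> 1) rK k0K => /=.
rewrite big1 ?mul0r => [<-|s _]; last by rewrite subrr.
by congr (_ / _); apply: eq_bigr => k _; rewrite mulr1.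
Qed.

(** The jump lies in another cell, so the step function is constant on this one and every paired
    difference vanishes. *)
Lemma cell_avg_haar_step K r q k0 :
  (r < K)%N -> (k0 < b ^ K)%N -> cell K r q != cell K r k0 ->
  cell_avg K r (fun k => haar K r k * (q <= k)%N%:R) k0 = 0.
Proof.
move=> rK k0K qk; rewrite cell_avg_haar // big1 ?mul0r // => s _.
apply/eqP; rewrite subr_eq0; apply/eqP; congr (nat_of_bool _)%:R.
set L := (b ^ (K - r.+1))%N; set W := (b ^ (K - r))%N.
have EL : (W = b * L)%N by rewrite -expnS subnSK.
have L0 : (0 < L)%N by exact: expb_gt0.
have W0 : (0 < W)%N by exact: expb_gt0.
have LW : (L + L <= W)%N by rewrite addnn -mul2n EL leq_mul2r hb orbT.
have sL : (s < L)%N := ltn_ord s.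
rewrite -/W -/L; set a := (cell K r k0 * W)%N.
move: qk; rewrite neq_ltn => /orP[h|h].
  have qa : (q < a)%N by rewrite -ltn_divLR.
  by rewrite -addnA !(leq_trans (ltnW qa)) // leq_addr.
have aq : (a + W <= q)%N by rewrite /a -mulSnr -leq_divRL.
have lt t : (t < W)%N -> (q <= a + t)%N = false.
  by move=> tW; apply/negbTE; rewrite -ltnNge (leq_trans _ aq) // ltn_add2l.
rewrite -addnA !lt // (leq_trans _ LW) ?ltn_add2l//.
by rewrite (leq_trans sL) // leq_addr.
Qed.

(** Paired points are [L] apart, so each of the [L] pairs gives [- L / b ^ K]; dividing by the cell
    length leaves a power of [b] free of [K]. *)
Lemma cell_avg_haar_lin K r k0 : (r < K)%N -> (k0 < b ^ K)%N ->
  cell_avg K r (fun k => haar K r k * (k.+1%:R / (b ^ K)%:R)) k0 =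
  - (b%:R ^+ (r + 2))^-1.
Proof.
move=> rK k0K; rewrite cell_avg_haar //.
set a := (_ * _)%N; set L := (b ^ _)%N.
rewrite (eq_bigr (fun=> - (L%:R / (b ^ K)%:R))); last first.
  move=> s _; rewrite -mulrBl -mulNr; congr (_ / _).
  by rewrite -addn1 -[(_ + _ + _).+1]addn1 !natrD; ring.
rewrite sumr_const card_ord -[_ *+ L]mulr_natr /L (natrX _ b (K - r.+1)) (natrX _ b K).
have [e ->] : exists e, K = (e + r.+1)%N by exists (K - r.+1)%N; rewrite subnK.
rewrite addnK (_ : (e + r.+1 - r = e.+1)%N); last by lia.
have := b_gt0; move: (b%:R) => B B0.
have r0 : B ^+ r != 0 by rewrite expf_neq0 ?gt_eqF.
have e0 : B ^+ e != 0 by rewrite expf_neq0 ?gt_eqF.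
rewrite !exprD !exprS expr0; field; rewrite r0 e0 gt_eqF//.
Qed.

End Cells.

(** * Averaging over cells of the grid *)

Section Grid.
Context (R : realType) (b : nat).
Hypothesis hb : (1 < b)%N.
Context (K d : nat).

Definition grid : finType := {ffun 'I_d -> 'I_(b ^ K)}.

Implicit Types (k : grid) (w r : 'I_d -> nat) (E : grid -> R).

Definition same_cell w k k' : bool :=
  [forall i, cell b K (w i) (k i) == cell b K (w i) (k' i)].

Definition cell_const w E := forall k k', same_cell w k k' -> E k = E k'.

Lemma prod_same_cell w k k' :
  \prod_i (cell b K (w i) (k i) == cell b K (w i) (k' i))%:R =
  (same_cell w k k')%:R :> R.
Proof.
have [/forallP h|] := boolP (same_cell w k k').
  by rewrite big1// => i _; rewrite h.
by move=> /forallPn[i /negbTE h]; rewrite (bigD1 i)//= h mul0r.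
Qed.

Lemma same_cellC w k k' : same_cell w k k' = same_cell w k' k.
Proof. by apply: eq_forallb => i; rewrite eq_sym. Qed.

Lemma sum_same_cell w k : (forall i, w i <= K)%N ->
  \sum_k' (same_cell w k' k)%:R = \prod_i b%:R ^+ (K - w i) :> R.
Proof.
move=> wK; rewrite (eq_bigr _ (fun k' _ => esym (prod_same_cell w k' k))).
transitivity (\prod_(i < d) \sum_(j < b ^ K)
    (cell b K (w i) j == cell b K (w i) (k i))%:R : R).
  by rewrite bigA_distr_bigA.
by apply: eq_bigr => i _; rewrite cell_sum1.
Qed.

(* Averaging over the cells of a function constant on them decouples the
   coordinates, since a cell is a product set. *)
Lemma sum_cell_avg w E (g : 'I_d -> nat -> R) :
  (forall i, w i <= K)%N -> cell_const w E ->
  \sum_k E k * \prod_i g i (k i) =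
  \sum_k E k * \prod_i cell_avg b K (w i) (g i) (k i).
Proof.
move=> wK Ew; set W := \prod_i (b%:R ^+ (K - w i) : R).
have W0 : W != 0.
  by apply/prodf_neq0 => i _; rewrite expf_neq0 // gt_eqF // b_gt0.
have avg k : \prod_i cell_avg b K (w i) (g i) (k i) =
    (\sum_(k' : grid) (same_cell w k' k)%:R * \prod_i g i (k' i)) / W.
  rewrite prodf_div; congr (_ / _); rewrite bigA_distr_bigA /=.
  by apply: eq_bigr => k' _; rewrite big_split /= prod_same_cell.
under [RHS]eq_bigr do rewrite avg mulrA big_distrr /=.
(* After the exchange of sums the averaging acts on [E], which is constant on cells and hence
   unchanged. *)
rewrite -mulr_suml exchange_big mulr_suml /=; apply: eq_bigr => k _.
rewrite (eq_bigr (fun k' => E k * (\prod_i g i (k i)) * (same_cell w k' k)%:R)).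
  by rewrite -big_distrr /= sum_same_cell // -/W mulfK.
move=> k' _; rewrite same_cellC; have [s|_] := boolP (same_cell w k' k).
  by rewrite (Ew _ _ s) mul1r mulr1.
by rewrite mul0r !mulr0.
Qed.

Lemma sum_cell_avg0 w E (g : 'I_d -> nat -> R) i :
  (forall i, w i <= K)%N -> cell_const w E ->
  (forall k : grid, cell_avg b K (w i) (g i) (k i) = 0) ->
  \sum_k E k * \prod_i g i (k i) = 0.
Proof.
move=> wK Ew g0; rewrite (sum_cell_avg (w := w)) // big1 // => k _.
by rewrite (bigD1 i) //= g0 mul0r mulr0.
Qed.

Lemma haar_norm_le1 (r t : nat) : `|haar R b K r t| <= 1.
Proof.
rewrite /haar; case: (_ %% _)%N => [|[|e]] /=;
  by rewrite ?subr0 ?sub0r ?normrN ?normr0 ?normr1 ?ler01.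
Qed.

(** The Haar function of level [r] reads the cell of level [r + 1], which explains the strict
    [r < s]. *)
Lemma haar_cell_const (r s k k' : nat) : (r < s <= K)%N ->
  cell b K s k = cell b K s k' -> haar R b K r k = haar R b K r k'.
Proof.
move=> /andP[rs sK]; rewrite /haar /cell.
have -> : (K - r.+1 = (K - s) + (s - r.+1))%N by clear -rs sK; lia.
by rewrite expnD !divnMA => ->.
Qed.

Lemma cell_coarsen (r s k k' : nat) : (r <= s <= K)%N ->
  cell b K s k = cell b K s k' -> cell b K r k = cell b K r k'.
Proof.
move=> /andP[rs sK]; rewrite /cell.
have -> : (K - r = (K - s) + (s - r))%N by clear -rs sK; lia.
by rewrite expnD !divnMA => ->.
Qed.

Lemma same_cell_coarsen w w' k k' : (forall i, w' i <= w i <= K)%N ->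
  same_cell w k k' -> same_cell w' k k'.
Proof.
move=> ww' /forallP h; apply/forallP => i; apply/eqP.
by apply: cell_coarsen (ww' i) _; exact/eqP.
Qed.

Lemma cell_full (k k' : nat) : cell b K K k = cell b K K k' -> k = k'.
Proof. by rewrite /cell subnn expn0 !divn1. Qed.

(** * Haar coefficients of the discrepancy and empty boxes *)

Section Discrepancy.
Context (N : nat) (q : 'I_N -> grid).

(** The comparison [q n i <= k i] is not strict because the index [k i] stands for the coordinate
    [(k i + 1) / b ^ K]. *)
Definition grid_discr k : R :=
  \sum_n \prod_i (q n i <= k i)%N%:R
  - N%:R * \prod_i ((k i).+1%:R / (b ^ K)%:R).

(** On the cell of a point [E] vanishes; on any other cell some coordinate separates the point, and
    there the step function averages to zero against the Haar function. Only the linear part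
    survives, with a factor [- b ^ -(r i + 2)] per coordinate. Allowing any such [E], not just an
    indicator, lets the same identity serve the Riesz product. *)
Lemma grid_discr_haar r E :
  (forall i, r i < K)%N -> cell_const r E -> (forall n, E (q n) = 0) ->
  \sum_k grid_discr k * (E k * \prod_i haar R b K (r i) (k i)) =
  - (N%:R * (-1) ^+ d / b%:R ^+ (\sum_i (r i + 2))%N * \sum_k E k).
Proof.
move=> rK Er Eq.
rewrite (eq_bigr (fun k =>
  (\sum_n E k * \prod_i (haar R b K (r i) (k i) * (q n i <= k i)%N%:R))
  - N%:R * (E k * \prod_i (haar R b K (r i) (k i) *
      ((k i).+1%:R / (b ^ K)%:R))))); last first.
  move=> k _; rewrite /grid_discr mulrBl mulr_suml; congr (_ - _).
    by apply: eq_bigr => n _; rewrite big_split /=; ring.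
  by rewrite [in RHS]big_split /=; ring.
rewrite big_split /= sumrN exchange_big /= big1 ?add0r => [|n _]; last first.
  rewrite (sum_cell_avg (w := r)
    (fun i t => haar R b K (r i) t * (q n i <= t)%N%:R)) //; last first.
    by move=> i; exact: ltnW.
  rewrite big1 // => k _; have [s|] := boolP (same_cell r (q n) k).
    by rewrite -(Er _ _ s) Eq mul0r.
  move=> /forallPn[i s]; rewrite (bigD1 i) //= cell_avg_haar_step //.
  by rewrite mul0r mulr0.
congr (- _); rewrite -mulr_sumr.
rewrite (sum_cell_avg (w := r)
  (fun i t => haar R b K (r i) t * (t.+1%:R / (b ^ K)%:R))) //; last first.
  by move=> i; exact: ltnW.
rewrite (eq_bigr (fun k => (-1) ^+ d / b%:R ^+ (\sum_i (r i + 2))%N * E k)).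
  by rewrite -mulr_sumr !mulrA.
move=> k _; rewrite (eq_bigr (fun i => -1 * (b%:R ^+ (r i + 2))^-1)).
  rewrite big_split /= prodr_const card_ord prodfV.
  by rewrite -expr_sum mulrC.
by move=> i _; rewrite mulN1r; apply: cell_avg_haar_lin.
Qed.

Definition empty_cell r k : R := [forall n, ~~ same_cell r (q n) k]%:R.

Lemma empty_cell_ge0 r k : 0 <= empty_cell r k.
Proof. exact: ler0n. Qed.

Lemma empty_cell_le1 r k : empty_cell r k <= 1.
Proof. by rewrite /empty_cell; case: [forall _, _]. Qed.

Lemma empty_cell0 r n k : same_cell r (q n) k -> empty_cell r k = 0.
Proof.
by move=> s; rewrite /empty_cell; case: forallP => // /(_ n); rewrite s.
Qed.

Lemma same_cell_trans w k1 k2 k3 :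
  same_cell w k1 k2 -> same_cell w k1 k3 = same_cell w k2 k3.
Proof.
by move=> /forallP h; apply: eq_forallb => i; rewrite (eqP (h i)).
Qed.

Lemma empty_cell_const r : cell_const r (empty_cell r).
Proof.
move=> k k' s; congr (nat_of_bool _)%:R; apply: eq_forallb => n.
by rewrite same_cellC (same_cell_trans _ s) same_cellC.
Qed.

(** Pointwise, the indicator of the empty boxes is at least 1 minus the number of points in the same
    box; each point accounts for one box in the sum. *)
Lemma sum_empty_cell r : (forall i, r i <= K)%N ->
  b%:R ^+ (K * d) * (1 - N%:R / b%:R ^+ (\sum_i r i)%N) <=
  \sum_k empty_cell r k.
Proof.
move=> rK.
have -> : b%:R ^+ (K * d) * (1 - N%:R / b%:R ^+ (\sum_i r i)%N) =
    \sum_k (1 - \sum_n (same_cell r (q n) k)%:R) :> R.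
  rewrite big_split /= sumrN exchange_big /= sumr_const.
  rewrite card_ffun !card_ord -expnM natrX mulrBr mulr1; congr (_ - _).
  have S n : \sum_k (same_cell r (q n) k)%:R = \prod_i b%:R ^+ (K - r i) :> R.
    rewrite -(sum_same_cell (q n)) //.
    by apply: eq_bigr => k _; rewrite same_cellC.
  rewrite (eq_bigr _ (fun n _ => S n)).
  rewrite sumr_const card_ord -[(\prod_i _) *+ _]mulr_natl mulrCA; congr (_ * _).
  have b0 : b%:R != 0 :> R by rewrite gt_eqF // b_gt0.
  apply: (mulIf (x := b%:R ^+ (\sum_i r i)%N)); first by rewrite expf_neq0.
  rewrite divfK ?expf_neq0 // expr_sum -big_split /=.
  rewrite (eq_bigr (fun=> b%:R ^+ K)) => [|i _]; last by rewrite -exprD subnK.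
  by rewrite prodr_const card_ord exprM.
apply: ler_sum => k _; rewrite /empty_cell.
case: forallP => [_|].
  by rewrite gerBl sumr_ge0// => n _; rewrite ler0n.
move=> /forallP/forallPn[n]; rewrite negbK => s.
by rewrite (bigD1 n) //= s opprD addrA subrr sub0r oppr_le0 sumr_ge0.
Qed.

End Discrepancy.
End Grid.

(** * The mean square bound *)

Section HaarSums.
Context (R : realType) (b : nat).
Hypothesis hb : (1 < b)%N.
Context (K d N : nat) (q : 'I_N -> grid b K d).

Implicit Types (k : grid b K d) (r s : 'I_d -> nat).

Definition haar_sum r k : R :=
  empty_cell R q r k * \prod_i haar R b K (r i) (k i).

Lemma haar_sum_norm_le1 r k : `|haar_sum r k| <= 1.
Proof.
rewrite normrM mulr_ile1 ?normr_ge0 //.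
  by rewrite ger0_norm ?empty_cell_ge0 ?empty_cell_le1.
by rewrite normr_prod prodr_ile1 // => i _; rewrite normr_ge0 haar_norm_le1.
Qed.

(** Averaging in direction [i] alone, over intervals of level [s i], kills the finer Haar factor,
    since all other factors are constant there. *)
Lemma haar_sum_orthogonal_lt r s i :
  (forall i, r i < K)%N -> (forall i, s i < K)%N -> (r i < s i)%N ->
  \sum_k haar_sum r k * haar_sum s k = 0.
Proof.
(* Level [K] means cells of a single grid point: the coordinates other than [i] are frozen. *)
move=> rK sK rs; pose w j := if j == i then s i else K.
have wE : w i = s i by rewrite /w eqxx.
have rw j : (r j < w j)%N by rewrite /w; case: eqP => [->|].
have sw j : (s j <= w j)%N by rewrite /w; case: eqP => [->|_ ] //; exact: ltnW.
have wK j : (w j <= K)%N by rewrite /w; case: eqP => [_|_] //; exact: ltnW.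
rewrite (eq_bigr (fun k => (haar_sum r k * empty_cell R q s k *
    \prod_(j | j != i) haar R b K (s j) (k j)) *
    \prod_j (if j == i then haar R b K (s i) (k j) else 1))); last first.
  move=> k _; have -> : \prod_j (if j == i then haar R b K (s i) (k j) else 1) =
      haar R b K (s i) (k i).
    by rewrite (bigD1 i) //= eqxx big1 ?mulr1 // => j /negbTE ->.
  by rewrite {2}/haar_sum (bigD1 i) //=; ring.
apply: (sum_cell_avg0 hb (w := w) (i := i)
  (g := fun j t => if j == i then haar R b K (s i) t else 1)) => //.
- move=> k k' kk'; have /forallP cw := kk'; rewrite /haar_sum.
  rewrite (@empty_cell_const R b K d N q r k k'); last first.
    by apply: same_cell_coarsen kk' => j; rewrite wK (ltnW (rw j)).
  rewrite (@empty_cell_const R b K d N q s k k'); last first.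
    by apply: same_cell_coarsen kk' => j; rewrite wK sw.
  congr (_ * _ * _ * _); apply: eq_bigr => j.
    by move=> _; apply: haar_cell_const (eqP (cw j)); rewrite rw wK.
  move=> /negbTE ji; have := eqP (cw j); rewrite /w ji.
  by move=> /cell_full ->.
- by move=> k; rewrite wE eqxx cell_avg_haar0.
Qed.

Lemma haar_sum_orthogonal r s i :
  (forall i, r i < K)%N -> (forall i, s i < K)%N -> r i != s i ->
  \sum_k haar_sum r k * haar_sum s k = 0.
Proof.
move=> rK sK; rewrite neq_ltn => /orP[h|h]; first exact: haar_sum_orthogonal_lt h.
by under eq_bigr do rewrite mulrC; exact: haar_sum_orthogonal_lt h.
Qed.

(** The exponent [2 * d] comes from the Haar coefficients of the linear part, the extra 2 from
    [b ^ n <= b ^ 2 * N], and the half from the share of empty boxes. *)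
Let c0 : R := (b%:R ^+ (2 * d + 2))^-1 / 2.

(** The sign collects one minus per coordinate and one from the linear term of the discrepancy. *)
Lemma discr_haar_sum_ge n r :
  (forall i, r i < K)%N -> (\sum_i r i = n)%N ->
  (2 * N <= b ^ n)%N -> (b ^ n <= b ^ 2 * N)%N ->
  c0 * b%:R ^+ (K * d) <=
  (-1) ^+ d.+1 * \sum_k grid_discr R q k * haar_sum r k.
Proof.
move=> rK rn N1 N2; rewrite grid_discr_haar //; last 2 first.
- exact: empty_cell_const.
- by move=> m; apply: (empty_cell0 _ (n := m)); apply/forallP.
have := sum_empty_cell R hb q (fun i => ltnW (rK i)).
set S := \sum_k empty_cell _ _ _ _; rewrite rn big_split /= rn sum_nat_const card_ord.
have -> : (d * 2 = 2 * d)%N by rewrite mulnC.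
rewrite /c0; set M := b%:R ^+ (K * d); set B := b%:R ^+ n.
have b0 := b_gt0 R hb.
have M0 : 0 < M by rewrite exprn_gt0.
have B0 : 0 < B by rewrite exprn_gt0.
have NB : 2 * N%:R <= B by rewrite /B -natrX -natrM ler_nat.
have BN : B <= b%:R ^+ 2 * N%:R by rewrite /B -natrX -natrX -natrM ler_nat.
move=> hS; have {}hS : M / 2 <= S.
  apply: le_trans hS; rewrite ler_pM2l // lerBrDl -lerBrDr.
  by rewrite ler_pdivrMr //; lra.
have -> : forall Z : R, (-1) ^+ d.+1 * - (N%:R * (-1) ^+ d / Z * S) =
    N%:R / Z * S * (((-1) ^+ d) ^+ 2) by move=> Z; rewrite exprS; ring.
rewrite sqrr_sign mulr1.
rewrite (exprD _ n) (exprD _ _ 2) -/B.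
set D := b%:R ^+ (2 * d); have D0 : 0 < D by rewrite exprn_gt0.
have bb0 : 0 < b%:R ^+ 2 :> R by rewrite exprn_gt0.
apply: (@le_trans _ _ (N%:R / (B * D) * (M / 2))); last first.
  apply: ler_wpM2l hS; apply: divr_ge0; first exact: ler0n.
  exact/ltW/mulr_gt0.
have -> : (D * b%:R ^+ 2)^-1 / 2 * M = (D * b%:R ^+ 2)^-1 * (M / 2).
  by rewrite mulrAC -mulrA.
apply: ler_wpM2r; first by rewrite divr_ge0 // ltW.
rewrite ler_pdivlMr ?mulr_gt0 // mulrC ler_pdivrMr ?mulr_gt0 //.
have -> : N%:R * (D * b%:R ^+ 2) = b%:R ^+ 2 * N%:R * D by ring.
by rewrite ler_pM2r.
Qed.

Lemma sum_sqr_discr_ge (A : finType) n (r : A -> 'I_d -> nat) :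
  (forall a i, r a i < K)%N -> (forall a, \sum_i r a i = n)%N ->
  (forall a a', a != a' -> exists i, r a i != r a' i) ->
  (2 * N <= b ^ n)%N -> (b ^ n <= b ^ 2 * N)%N ->
  c0 ^+ 2 * #|A|%:R * b%:R ^+ (K * d) <=
  \sum_k grid_discr R q k ^+ 2.
Proof.
move=> rK rn rneq N1 N2; set M := b%:R ^+ (K * d).
pose F k := \sum_a haar_sum (r a) k.
pose D k := grid_discr R q k.
(* With correlation at least [c0 * M * #|A|] and [F] of squared norm at most [M * #|A|], the bound
   [2 t c0 - t ^ 2] is largest at [c0]; the sign is that of the correlations. *)
pose t := c0 * (-1) ^+ d.+1.
have tt : t ^+ 2 = c0 ^+ 2 by rewrite exprMn sqrr_sign mulr1.
have c00 : 0 < c0 by rewrite divr_gt0 // invr_gt0 exprn_gt0 // b_gt0.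
have DF : c0 * (c0 * M *+ #|A|) <= t * \sum_k D k * F k.
  have -> : \sum_k D k * F k = \sum_a \sum_k D k * haar_sum (r a) k.
    by rewrite exchange_big /=; apply: eq_bigr => k _; rewrite mulr_sumr.
  rewrite /t -mulrA ler_pM2l // mulr_sumr -sumr_const.
  by apply: ler_sum => a _; exact: discr_haar_sum_ge (rn a) N1 N2.
have FF : \sum_k F k ^+ 2 <= M *+ #|A|.
  have -> : \sum_k F k ^+ 2 =
      \sum_a \sum_a' \sum_k haar_sum (r a) k * haar_sum (r a') k.
    rewrite (eq_bigr (fun k => \sum_a \sum_a' haar_sum (r a) k * haar_sum (r a') k)).
      rewrite exchange_big /=; apply: eq_bigr => a _; exact: exchange_big.
    by move=> k _; rewrite expr2 mulr_suml; apply: eq_bigr => a _; rewrite mulr_sumr.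
  rewrite -sumr_const; apply: ler_sum => a _.
  rewrite (bigD1 a) //= [X in _ + X]big1 ?addr0; last first.
    by move=> a' /rneq[i ne]; apply: (haar_sum_orthogonal (i := i)) => //; rewrite eq_sym.
  have -> : M = \sum_(k : grid b K d) 1.
    by rewrite sumr_const card_ffun !card_ord -expnM natrX.
  apply: ler_sum => k _; rewrite -expr2.
  by rewrite -real_normK ?num_real // exprn_ile1 ?normr_ge0 // haar_sum_norm_le1.
have : 0 <= \sum_k (D k - t * F k) ^+ 2 by apply: sumr_ge0 => k _; exact: sqr_ge0.
rewrite (eq_bigr (fun k => D k ^+ 2 + (- (2 * t)) * (D k * F k) + c0 ^+ 2 * F k ^+ 2)).
  rewrite !big_split /= -!mulr_sumr.
  have := ler_wpM2l (sqr_ge0 c0) FF; move: DF.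
  rewrite -[M *+ #|A|]mulr_natr -[(c0 * M) *+ #|A|]mulr_natr.
  move: (\sum_k D k * F k) (\sum_k F k ^+ 2) (\sum_k _) => x y z.
  lra.
by move=> k _; rewrite -tt; ring.
Qed.

End HaarSums.

(** * The Riesz product in dimension two *)

(** The terms of the expansion are grouped by the largest index selected. *)
Lemma prod_one_plus_last (R : pzRingType) (x : nat -> R) n :
  \prod_(l < n) (1 + x l) =
  1 + \sum_(m < n) (\prod_(l < m) (1 + x l)) * x m.
Proof.
elim: n => [|n IH]; first by rewrite !big_ord0 addr0.
by rewrite big_ord_recr /= mulrDr mulr1 {1}IH big_ord_recr /= addrA.
Qed.

(** Here the grouping is by the smallest index; combined with the previous identity it isolates the
    extreme levels [l < m]. *)
Lemma prod_one_plus_first (R : pzRingType) (x : nat -> R) n :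
  \prod_(l < n) (1 + x l) =
  1 + \sum_(l < n) x l * \prod_(l.+1 <= j < n) (1 + x j).
Proof.
elim: n => [|n IH]; first by rewrite !big_ord0 addr0.
rewrite big_ord_recr /= IH big_ord_recr /= big_geq // mulr1.
rewrite mulrDl mul1r mulr_suml -!addrA; congr (_ + _); rewrite addrC.
by congr (_ + _); apply: eq_bigr => l _; rewrite big_nat_recr // mulrA.
Qed.

Lemma sum_geometric_le3 (R : realFieldType) m :
  \sum_(l < m) (3 / 4 : R) ^+ (m - l) <= 3.
Proof.
elim: m => [|m IH]; first by rewrite big_ord0.
rewrite big_ord_recr /= subSnn expr1.
rewrite (eq_bigr (fun l : 'I_m => 3 / 4 * (3 / 4) ^+ (m - l))).
  by rewrite -mulr_sumr; lra.
by move=> l _; rewrite subSn ?exprS // ltnW.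
Qed.

Lemma normM_le (R : realDomainType) (x y c : R) :
  `|x| <= c -> `|y| <= 1 -> `|x * y| <= c.
Proof. by move=> xc y1; rewrite normrM; apply: le_trans xc; exact: ler_piMr. Qed.

Section RieszProduct.
Context (R : realType) (b : nat).
Hypothesis hb : (1 < b)%N.
Context (K N n : nat) (q : 'I_N -> grid b K 2).
Hypothesis nK : (n < K)%N.

Implicit Types (k : grid b K 2).

Definition level2 (u v : nat) (i : 'I_2) : nat := if val i == 0%N then u else v.

Lemma prod_level2 (F : nat -> nat -> R) (u v : nat) k :
  \prod_i F (level2 u v i) (k i) = F u (k ord0) * F v (k ord_max).
Proof.
rewrite big_ord_recl big_ord1 /=; congr (_ * F _ (k _)); exact: val_inj.
Qed.

Lemma haar_sum_cell_const d (p : 'I_N -> grid b K d) (r w : 'I_d -> nat) :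
  (forall i, r i < w i <= K)%N -> cell_const w (haar_sum R p r).
Proof.
move=> rw k k' kk'; have /forallP cw := kk'.
rewrite /haar_sum (@empty_cell_const R b K d N p r k k'); last first.
  apply: same_cell_coarsen kk' => j; have /andP[h1 h2] := rw j.
  by rewrite h2 ltnW.
congr (_ * _); apply: eq_bigr => j _.
exact: haar_cell_const (eqP (cw j)).
Qed.

Local Notation f l := (haar_sum R q (level2 l (n - l))).

(* Makes the pair terms, at most [3 g b^-5] per level, no more than half of the
   main term [b^-6 / 2]. *)
Definition riesz_coef : R := (12 * b%:R)^-1.
Local Notation g := riesz_coef.

Definition riesz m k : R := \prod_(l < m) (1 + g * f l k).

Definition riesz_between l m k : R := \prod_(l.+1 <= j < m) (1 + g * f j k).

Lemma riesz_coef_gt0 : 0 < g.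
Proof. by rewrite invr_gt0 mulr_gt0 // b_gt0. Qed.

Lemma riesz_coef_le : g <= 1 / 2.
Proof.
rewrite /g; have b1 : 1 <= b%:R :> R by rewrite ler1n ltnW.
by rewrite div1r lef_pV2 ?posrE; lra.
Qed.

(** Each factor of the product thus lies between 1/2 and 3/2, which gives both positivity and the
    growth rate 3/2. *)
Lemma riesz_factor_norm l k : `|g * f l k| <= 1 / 2.
Proof.
rewrite normrM (gtr0_norm riesz_coef_gt0).
apply: le_trans riesz_coef_le; apply: ler_piMr; first exact/ltW/riesz_coef_gt0.
exact: haar_sum_norm_le1.
Qed.

Lemma riesz_ge0 m k : 0 <= riesz m k.
Proof.
apply: prodr_ge0 => l _; have := riesz_factor_norm l k.
by rewrite ler_norml => /andP[h _]; lra.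
Qed.

Lemma riesz_between_norm l m k : `|riesz_between l m k| <= (3 / 2) ^+ (m - l.+1).
Proof.
rewrite /riesz_between normr_prod.
have -> : (3 / 2) ^+ (m - l.+1) = \prod_(l.+1 <= j < m) (3 / 2 : R).
  by rewrite prodr_const_nat.
apply: ler_prod => j _; rewrite normr_ge0 /=.
by apply: le_trans (ler_normD _ _) _; rewrite normr1; have := riesz_factor_norm j k; lra.
Qed.

(** In the first coordinate [f m] has level [m], strictly finer than all factors of [riesz m], so
    averaging in that coordinate over cells of level [m] gives zero. *)
Lemma sum_haar_riesz m : (m < n)%N -> \sum_k riesz m k * f m k = 0.
Proof.
move=> mn; pose w := level2 m K.
rewrite (eq_bigr (fun k => (riesz m k * empty_cell R q (level2 m (n - m)) k *
    haar R b K (n - m) (k ord_max)) *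
    \prod_i (if val i == 0%N then haar R b K m (k i) else 1))); last first.
  move=> k _; rewrite [in RHS]big_ord_recl big_ord1 /= mulr1.
  by rewrite /haar_sum prod_level2; ring.
apply: (sum_cell_avg0 hb (w := w) (i := ord0)
  (g := fun i t => if val i == 0%N then haar R b K m t else 1)).
- by move=> i; rewrite /w /level2; case: eqP => // _; lia.
- move=> k k' kk'; have /forallP cw := kk'.
  rewrite (@empty_cell_const R b K 2 N q _ k k'); last first.
    by apply: same_cell_coarsen kk' => j; rewrite /w /level2; case: eqP => _; lia.
  congr (_ * _ * _).
    apply: eq_bigr => l _; congr (1 + _ * _); apply: haar_sum_cell_const kk' => i.
    by have := ltn_ord l; rewrite /w /level2; case: eqP => _; lia.
  by have := eqP (cw ord_max) => /= /cell_full ->.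
- move=> k; have mK : (m < K)%N by lia.
  exact: (cell_avg_haar0 R hb mK (ltn_ord (k ord0))).
Qed.

(** Grouped by largest level, every term but the constant 1 has mean zero. With positivity this
    bounds the [L^1] norm of [riesz n - 1]. *)
Lemma sum_riesz : \sum_k riesz n k = b%:R ^+ (K * 2).
Proof.
rewrite (eq_bigr (fun k => 1 + g * \sum_(m < n) riesz m k * f m k)); last first.
  move=> k _; rewrite {1}/riesz (prod_one_plus_last (fun l => g * f l k)) mulr_sumr.
  congr (_ + _).
  by apply: eq_bigr => m _; rewrite -/(riesz m k); ring.
rewrite big_split /= -mulr_sumr exchange_big /= [X in g * X]big1 => [|m _].
  by rewrite mulr0 addr0 sumr_const card_ffun !card_ord -expnM natrX.
exact: sum_haar_riesz.
Qed.

Hypothesis N1 : (b * N <= b ^ n)%N.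

(** The finest level is [m] in the first coordinate, from [f m], and [n - l] in the second, from
    [f l]. All other factors are constant on cells of levels [(m, n - l)] and go into [E], so
    [grid_discr_haar] applies. *)
Lemma discr_riesz_pair l m : (l < m < n)%N ->
  `|\sum_k grid_discr R q k * (f l k * riesz_between l m k * f m k)| <=
  (b%:R ^+ 5)^-1 * (3 / 4) ^+ (m - l) * b%:R ^+ (K * 2).
Proof.
move=> /andP[lm mn].
pose E k := empty_cell R q (level2 l (n - l)) k *
  empty_cell R q (level2 m (n - m)) k * riesz_between l m k *
  haar R b K l (k ord0) * haar R b K (n - m) (k ord_max).
pose r := level2 m (n - l).
have rK i : (r i < K)%N by rewrite /r /level2; case: eqP => _; lia.
rewrite (eq_bigr (fun k => grid_discr R q k *
    (E k * \prod_i haar R b K (r i) (k i)))); last first.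
  by move=> k _; rewrite /haar_sum /r !prod_level2 /E; ring.
rewrite grid_discr_haar //; last 2 first.
- move=> k k' kk'; have /forallP cw := kk'; rewrite /E.
  rewrite (@empty_cell_const R b K 2 N q (level2 l (n - l)) k k'); last first.
    by apply: same_cell_coarsen kk' => j; rewrite /r /level2; case: eqP => _; lia.
  rewrite (@empty_cell_const R b K 2 N q (level2 m (n - m)) k k'); last first.
    by apply: same_cell_coarsen kk' => j; rewrite /r /level2; case: eqP => _; lia.
  congr (_ * _ * _ * _).
  + apply: eq_big_nat => j /andP[lj jm]; congr (1 + _ * _).
    apply: haar_sum_cell_const kk' => i.
    by rewrite /r /level2; case: eqP => _; lia.
  + by apply: haar_cell_const (eqP (cw ord0)); rewrite /r /level2 /=; lia.
  + by apply: haar_cell_const (eqP (cw ord_max)); rewrite /r /level2 /=; lia.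
(* The box of levels [(m, n - m)] around a point is not empty, so the indicator coming from [f m]
   vanishes. *)
- move=> i; rewrite /E (empty_cell0 _ (r := level2 m (n - m)) (n := i)).
    by rewrite mulr0 !mul0r.
  exact/forallP.
have Ele k : `|E k| <= (3 / 2) ^+ (m - l.+1).
  apply: normM_le (haar_norm_le1 _ _ _ _ _).
  apply: normM_le (haar_norm_le1 _ _ _ _ _).
  rewrite mulrC; apply: normM_le (riesz_between_norm _ _ _) _.
  rewrite normrM mulr_ile1 // ger0_norm ?empty_cell_ge0 ?empty_cell_le1 //.
have SE : `|\sum_k E k| <= (3 / 2) ^+ (m - l.+1) * b%:R ^+ (K * 2).
  apply: le_trans (ler_norm_sum _ _ _) _.
  have -> : (3 / 2) ^+ (m - l.+1) * b%:R ^+ (K * 2) =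
      \sum_(k : grid b K 2) (3 / 2) ^+ (m - l.+1) :> R.
    by rewrite sumr_const card_ffun !card_ord -expnM -[RHS]mulr_natr natrX.
  by apply: ler_sum.
(* The levels [m] and [n - l] sum to [n + (m - l)]; this surplus yields a decay of at least 1/2 per
   level, against the growth 3/2 of [E]. *)
have -> : (\sum_i (r i + 2) = n + 5 + (m - l.+1))%N.
  by rewrite big_ord_recl big_ord1 /r /level2 /=; lia.
rewrite normrN normrM normrM normfV normrM normrX normrN1 expr1n mulr1.
rewrite normrX !normr_nat.
have b0 := b_gt0 R hb; have B0 e : 0 < b%:R ^+ e :> R by rewrite exprn_gt0.
have -> : (m - l = (m - l.+1).+1)%N by lia.
move: (m - l.+1)%N SE => e SE.
have NB : N%:R / b%:R ^+ (n + 5 + e) <= (b%:R ^+ 5 * 2 ^+ e.+1 : R)^-1.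
  rewrite ler_pdivrMr // [leRHS]mulrC ler_pdivlMr ?mulr_gt0 ?exprn_gt0 //.
  have hN : 2 * N%:R <= b%:R ^+ n :> R.
    by rewrite -natrM -natrX ler_nat (leq_trans _ N1) // leq_mul2r hb orbT.
  have h2 : 2 ^+ e <= b%:R ^+ e :> R.
    by apply: lerXn2r; rewrite ?nnegrE ?ler0n ?ler_nat.
  rewrite 2!exprD [in leRHS]mulrAC (exprS _ e).
  have -> : N%:R * (b%:R ^+ 5 * (2 * 2 ^+ e)) = 2 * N%:R * 2 ^+ e * b%:R ^+ 5 :> R.
    by ring.
  rewrite ler_pM2r //; apply: ler_pM hN h2; last exact: exprn_ge0.
  by rewrite mulr_ge0 // ler0n.
have NB0 : 0 <= N%:R / b%:R ^+ (n + 5 + e) :> R by rewrite divr_ge0 // ltW.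
apply: le_trans (ler_pM NB0 (normr_ge0 _) NB SE) _.
have e2 : 2 ^+ e != 0 :> R by rewrite expf_neq0 // pnatr_eq0.
have -> : (3 / 2) ^+ e = (3 / 4) ^+ e * 2 ^+ e :> R.
  by rewrite -exprMn; congr (_ ^+ _); field.
rewrite !(exprS _ e).
have B5 := B0 5; have BM := B0 (K * 2)%N.
have z0 : 0 < (3 / 4) ^+ e :> R by apply: exprn_gt0; lra.
move: (b%:R ^+ 5) (b%:R ^+ (K * 2)) ((3 / 4) ^+ e) (2 ^+ e) e2 B5 BM z0.
move=> B M z t t0 B5 M0 z0.
have -> : (B * (2 * t))^-1 * (z * t * M) = B^-1 * z * M * (1 / 2).
  by field; rewrite t0 gt_eqF.
have -> : B^-1 * (3 / 4 * z) * M = B^-1 * z * M * (3 / 4) by ring.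
by rewrite ler_pM2l ?mulr_gt0 ?invr_gt0 //; lra.
Qed.

Lemma discr_riesz : (b ^ n <= b ^ 2 * N)%N ->
  \sum_k grid_discr R q k * (riesz n k - 1) <=
  - (n%:R * g / 4 / b%:R ^+ 6) * b%:R ^+ (K * 2).
Proof.
move=> N2; set M := b%:R ^+ (K * 2); pose D k := grid_discr R q k.
have b0 := b_gt0 R hb.
have M0 : 0 < M by rewrite exprn_gt0.
have [B B0 EB] : exists2 B : R, 0 < B & b%:R ^+ 5 = B.
  by exists (b%:R ^+ 5); rewrite ?exprn_gt0.
(* In dimension two the sign is [(-1) ^ 3] and the constant is [b ^ -6 / 2]. *)
have main m : (m < n)%N -> \sum_k D k * f m k <= - ((b%:R * B)^-1 / 2) * M.
  move=> mn; rewrite -EB -exprS.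
  have := @discr_haar_sum_ge R b hb K 2 N q n (level2 m (n - m)).
  rewrite -signr_odd /= expr1 mulN1r -/M mulNr lerNr; apply => //.
  - by move=> i; rewrite /level2; case: eqP => _; lia.
  - by rewrite big_ord_recl big_ord1 /level2 /= subnKC // ltnW.
  - by apply: leq_trans N1; rewrite leq_mul2r hb orbT.
have pair m : (m < n)%N ->
    \sum_(l < m) \sum_k D k * (f l k * riesz_between l m k * f m k) <= 3 * B^-1 * M.
  move=> mn; apply: (@le_trans _ _ (\sum_(l < m) B^-1 * (3 / 4) ^+ (m - l) * M)).
    apply: ler_sum => l _; apply: le_trans (ler_norm _) _; rewrite -EB.
    by apply: discr_riesz_pair; rewrite ltn_ord.
  rewrite -mulr_suml -mulr_sumr (mulrC 3 B^-1) ler_pM2r // ler_pM2l ?invr_gt0 //.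
  exact: sum_geometric_le3.
(* By the choice of [g], the pairs add at most [g * 3 * b ^ -5 = b ^ -6 / 4], leaving half of the
   main term. *)
have each m : (m < n)%N ->
    \sum_k D k * (riesz m k * f m k) <= - (1 / 4 / (b%:R * B)) * M.
  move=> mn.
  have -> : \sum_k D k * (riesz m k * f m k) = \sum_k D k * f m k +
      g * \sum_(l < m) \sum_k D k * (f l k * riesz_between l m k * f m k).
    rewrite exchange_big mulr_sumr -big_split /=; apply: eq_bigr => k _.
    rewrite {1}/riesz (prod_one_plus_first (fun l => g * f l k)).
    rewrite (mulrDl 1) mul1r (mulrDr (D k)) mulr_suml !mulr_sumr; congr (_ + _).
    by apply: eq_bigr => l _; rewrite -/(riesz_between l m k); ring.
  apply: le_trans (lerD (main m mn) (ler_wpM2l (ltW riesz_coef_gt0) (pair m mn))) _.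
  rewrite le_eqVlt; apply/orP; left; apply/eqP; rewrite /riesz_coef.
  by field; rewrite !gt_eqF.
have -> : \sum_k D k * (riesz n k - 1) =
    \sum_(m < n) g * \sum_k D k * (riesz m k * f m k).
  rewrite -mulr_sumr exchange_big mulr_sumr /=; apply: eq_bigr => k _.
  rewrite {1}/riesz (prod_one_plus_last (fun l => g * f l k)) addrAC subrr add0r.
  rewrite !mulr_sumr; apply: eq_bigr => m _; rewrite -/(riesz m k); ring.
apply: (@le_trans _ _ (\sum_(m < n) g * (- (1 / 4 / (b%:R * B)) * M))).
  by apply: ler_sum => m _; rewrite ler_pM2l ?riesz_coef_gt0 // each.
rewrite sumr_const card_ord -[_ *+ n]mulr_natl exprS EB.
rewrite le_eqVlt; apply/orP; left; apply/eqP.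
by field; rewrite !gt_eqF.
Qed.

(** Duality: a uniform bound [X] on the discrepancy bounds its correlation with [riesz n - 1] by [X]
    times the [L^1] norm. *)
Lemma discr_log_ge : (0 < n)%N -> (b ^ n <= b ^ 2 * N)%N ->
  exists k, n%:R * g / 9 / b%:R ^+ 6 <= `|grid_discr R q k|.
Proof.
move=> n0 N2; set X := _ / _.
have [/existsP[k hk]|/existsPn hX] :=
  boolP [exists k, X <= `|grid_discr R q k|]; first by exists k.
have b0 := b_gt0 R hb.
have X0 : 0 < X.
  apply: divr_gt0; last exact: exprn_gt0.
  by apply: divr_gt0 => //; rewrite mulr_gt0 ?ltr0n ?riesz_coef_gt0.
have M0 : 0 < b%:R ^+ (K * 2) :> R by rewrite exprn_gt0.
have := discr_riesz N2.
(* The 9 in [X] makes the correlation at least [9 / 4 * X] per grid point, strictly above the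
   [2 * X] allowed by duality. *)
have -> : n%:R * g / 4 / b%:R ^+ 6 = 9 / 4 * X.
  by rewrite /X; field; rewrite gt_eqF.
move=> h; exfalso; move: h; apply/negP; rewrite -ltNge.
apply: (@lt_le_trans _ _ (- (2 * X * b%:R ^+ (K * 2)))).
  by rewrite mulNr ltrN2 ltr_pM2r //; lra.
rewrite lerNl -sumrN.
have -> : 2 * X * b%:R ^+ (K * 2) =
    \sum_(k : grid b K 2) X * (riesz n k + 1) :> R.
  rewrite -mulr_sumr big_split /= sum_riesz sumr_const card_ffun !card_ord.
  by rewrite -expnM natrX; ring.
apply: ler_sum => k _; apply: le_trans (ler_norm _) _; rewrite normrN normrM.
apply: ler_pM => //; first by rewrite ltW // ltNge hX.
apply: le_trans (ler_normB _ _) _.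
by rewrite normr1 ger0_norm // riesz_ge0.
Qed.

End RieszProduct.

(** * Back to points in the unit cube *)

Lemma quadratic_mean_le_max (R : rcfType) (T : finType) (x0 : T) (F : T -> R) :
  (forall x, 0 <= F x) ->
  exists x, Num.sqrt (#|T|%:R^-1 * \sum_x F x ^+ 2) <= F x.
Proof.
move=> F0; case: (arg_maxP F (isT : predT x0)) => x _ Fx; exists x.
have T0 : 0 < #|T|%:R :> R by rewrite ltr0n; apply/card_gt0P; exists x0.
rewrite -[leRHS](ger0_norm (F0 x)) -sqrtr_sqr ler_wsqrtr // ler_pdivrMl //.
rewrite mulr_natl -sumr_const; apply: ler_sum => y _.
by apply: lerXn2r; rewrite ?nnegrE ?F0 //; exact: Fx.
Qed.

Lemma discrepancy_grid (R : realType) (b K d N : nat) (P : 'I_N -> 'rV[R]_d) :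
  (1 < b)%N -> (forall n, unit_cube (P n)) ->
  exists q : 'I_N -> grid b K d, forall k,
    discrepancy (grid_point R k) P = grid_discr R q k.
Proof.
move=> hb P1; pose M := (b ^ K)%N.
have M0 : 0 < M%:R :> R by rewrite ltr0n expb_gt0.
have MP0 n i : 0 <= M%:R * P n 0 i.
  by have /andP[h _] := P1 n i; rewrite mulr_ge0 // ltW.
pose t n i := Num.truncn (M%:R * P n 0 i).
have tM n i : (t n i < M)%N.
  by have /andP[_ h] := P1 n i; rewrite truncn_lt_nat // gtr_pMr.
exists (fun n => [ffun i => Ordinal (tM n i)]) => k.
rewrite /discrepancy /grid_discr; congr (_ - _ * _); last first.
  by apply: eq_bigr => i _; rewrite mxE.
apply: eq_bigr => n _; rewrite indicE.
(* For a nonnegative real, lying below [k + 1] is the same as having integer part at most [k]. *)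
have iE i : (t n i <= k i)%N =
    (0 <= P n 0 i < grid_point R k 0 i).
  have /andP[-> _] := P1 n i.
  by rewrite mxE /t truncn_le_nat ltr_pdivlMr // mulrC.
case: (boolP [forall i, t n i <= k i]%N) => [/forallP h|].
  rewrite big1 => [|i _]; last by rewrite ffunE /= h.
  by rewrite mem_set // => i; rewrite -iE h.
move=> /forallPn[i h]; rewrite (bigD1 i) //= ffunE /= (negbTE h) mul0r.
rewrite memNset // => /(_ i); rewrite -iE; exact/negP.
Qed.

(** The witnesses are [n = nu] and [K = nu + tau]; [tau >= 1] gives [n < K]. *)
Lemma scale_exponents (R : realType) (b N M : nat) (nu tau : int) :
  (1 < b)%N -> (0 < N)%N ->
  (b%:R : R) ^ (nu - 2) <= N%:R < (b%:R : R) ^ (nu - 1) ->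
  1 <= tau -> (M%:R : R) = b%:R ^ (nu + tau) ->
  exists n K, [/\ (0 < n < K)%N, M = (b ^ K)%N,
    (b * N <= b ^ n)%N & (b ^ n <= b ^ 2 * N)%N].
Proof.
move=> hb N0 /andP[lN uN] tau1 ME.
have b1 : 1 <= b%:R :> R by rewrite ler1n ltnW.
(* Otherwise [b ^ (nu - 1) <= 1], contradicting [1 <= N]. *)
have nu2 : 2 <= nu.
  rewrite leNgt; apply/negP => nu2.
  have : (b%:R : R) ^ (nu - 1) <= b%:R ^ (0 : int) by apply: ler_weXz2l => //; lia.
  rewrite expr0z => /(lt_le_trans uN); rewrite ltrn1; lia.
have [n En] : exists n : nat, nu = n.+2 by exists (`|nu| - 2)%N; lia.
have [t Et] : exists t : nat, tau = t.+1 by exists (`|tau| - 1)%N; lia.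
move: lN uN ME; rewrite {}En {}Et {nu2 tau1 nu tau}.
have -> : (n.+2%:Z - 2 = n)%R by lia.
have -> : (n.+2%:Z - 1 = n.+1)%R by lia.
rewrite -PoszD -!exprnP -!natrX => lN uN /eqP; rewrite eqr_nat => /eqP ->.
exists n.+2, (n.+2 + t.+1)%N; split => //; first by lia.
  by rewrite expnS leq_pmul2l ?(ltnW hb) //; move: uN; rewrite ltr_nat => /ltnW.
by rewrite -addn2 addnC expnD leq_pmul2l ?expn_gt0 ?(ltnW hb) // -(ler_nat R).
Qed.

(** The crude [ln b <= b - 1] suffices, as constants may depend on [b]. *)
Lemma ln_le_exponent (R : realType) (b N n : nat) :
  (1 < b)%N -> (0 < N)%N -> (N <= b ^ n)%N ->
  ln N%:R <= n%:R * b%:R :> R.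
Proof.
move=> hb N0 Nb; have b0 := b_gt0 R hb.
apply: (@le_trans _ _ (ln (b%:R ^+ n))).
  by rewrite ler_ln ?posrE ?ltr0n ?exprn_gt0 // -natrX ler_nat.
rewrite lnXn // -[leLHS]mulr_natl ler_wpM2l //.
rewrite -[X in ln X](subrK 1) addrC.
by apply: le_trans (le_ln1Dx _) _; lra.
Qed.

Lemma sum_sqr_discr_log_ge (R : realType) (b K d N n : nat)
    (q : 'I_N -> grid b K d.+1) :
  (1 < b)%N -> (n < K)%N -> (b * N <= b ^ n)%N -> (b ^ n <= b ^ 2 * N)%N ->
  ((b%:R ^+ (2 * d.+1 + 2))^-1 / 2) ^+ 2 * (n %/ d.+1).+1%:R ^+ d <=
  (b%:R ^+ (K * d.+1))^-1 * \sum_k grid_discr R q k ^+ 2.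
Proof.
move=> hb nK N1 N2; set m := (n %/ d.+1)%N.
rewrite ler_pdivlMl ?exprn_gt0 ?b_gt0 // mulrC.
pose A : finType := {ffun 'I_d -> 'I_m.+1}.
(* The last [d] levels range freely up to [n / (d + 1)], so their sum is at most [n]; the first
   coordinate takes the remainder. *)
pose r (a : A) (i : 'I_d.+1) : nat :=
  if unlift ord0 i is Some j then a j else (n - \sum_j a j)%N.
have rl a j : r a (lift ord0 j) = a j by rewrite /r liftK.
have r0 a : r a ord0 = (n - \sum_j a j)%N by rewrite /r unlift_none.
have an (a : A) : (\sum_j a j <= n)%N.
  apply: (@leq_trans (\sum_(j < d) m)%N).
    by apply: leq_sum => j _; rewrite -ltnS.
  rewrite sum_nat_const card_ord; apply: leq_trans (leq_trunc_div n d.+1).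
  by rewrite mulnC leq_mul2l leqnSn orbT.
have rs a : (\sum_i r a i = n)%N.
  rewrite big_ord_recl r0 (eq_bigr _ (fun j _ => rl a j)) subnK //.
have -> : (m.+1%:R ^+ d : R) = #|A|%:R by rewrite card_ffun !card_ord natrX.
apply: (@sum_sqr_discr_ge _ b hb K d.+1 N q A n r) => //.
- move=> a i; apply: leq_ltn_trans nK; rewrite -(rs a) (bigD1 i) //=.
  exact: leq_addr.
- move=> a a' ne; have : [exists j, a j != a' j].
    by apply: contraNT ne => /existsPn h; apply/eqP/ffunP => j;
      apply/eqP; have := h j; rewrite negbK.
  by move=> /existsP[j h]; exists (lift ord0 j); rewrite !rl.
- by apply: leq_trans N1; rewrite leq_mul2r hb orbT.
Qed.

Theorem theorem1 (R : realType) (b : nat) (hb : (1 < b)%N) :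
  (forall d : nat, (1 <= d)%N ->
    exists c : R, 0 < c /\
    forall (N : nat) (nu tau : int) (M : nat) (P : 'I_N -> 'rV[R]_d),
      (0 < N)%N ->
      (b%:R : R) ^ (nu - 2) <= N%:R < (b%:R : R) ^ (nu - 1) ->
      1 <= tau ->
      (M%:R : R) = b%:R ^ (nu + tau) ->
      (forall n, unit_cube (P n)) ->
      c * ln (N%:R : R) `^ ((d%:R - 1) / 2) <=
        Num.sqrt ((M%:R ^+ d)^-1 *
          \sum_(j : {ffun 'I_d -> 'I_M})
             `|discrepancy (grid_point R j) P| ^+ 2)
      /\ exists j : {ffun 'I_d -> 'I_M},
           c * ln (N%:R : R) `^ ((d%:R - 1) / 2) <=
             `|discrepancy (grid_point R j) P|)
  /\
  (exists c' : R, 0 < c' /\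
    forall (N : nat) (nu tau : int) (M : nat) (P : 'I_N -> 'rV[R]_2),
      (0 < N)%N ->
      (b%:R : R) ^ (nu - 2) <= N%:R < (b%:R : R) ^ (nu - 1) ->
      1 <= tau ->
      (M%:R : R) = b%:R ^ (nu + tau) ->
      (forall n, unit_cube (P n)) ->
      exists j : {ffun 'I_2 -> 'I_M},
        c' * ln (N%:R : R) <= `|discrepancy (grid_point R j) P|).
Proof.
have b0 := b_gt0 R hb; split => [[//|d] _|].
  pose c0 : R := (b%:R ^+ (2 * d.+1 + 2))^-1 / 2.
  have c00 : 0 < c0 by rewrite divr_gt0 // invr_gt0 exprn_gt0.
  pose e : R := (d.+1%:R - 1) / 2.
  have eE : e = d%:R / 2 by rewrite /e -natr1 addrK.
  have e0 : 0 <= e by rewrite eE divr_ge0.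
  have db0 : 0 < d.+1%:R * b%:R :> R by rewrite mulr_gt0.
  exists (c0 / (d.+1%:R * b%:R) `^ e); split; first by rewrite divr_gt0 // powR_gt0.
  move=> N nu tau M P N0 hN tau1 hM P1; rewrite -/e.
  have [n [K [/andP[n0 nK] EM N1 N2]]] := scale_exponents hb N0 hN tau1 hM.
  subst M; have [q qE] := discrepancy_grid K hb P1.
  set m := (n %/ d.+1).+1.
  have Nn : (N <= b ^ n)%N by apply: leq_trans N1; rewrite leq_pmull // ltnW.
  have logN0 : 0 <= ln (N%:R : R) by rewrite ln_ge0 // ler1n.
  set X := _ / _ * _; set Q := _^-1 * _.
  have X0 : 0 <= X by rewrite mulr_ge0 ?powR_ge0 // divr_ge0 ?powR_ge0 // ltW.
  (* The divisor in the constant comes from [ln N <= n * b <= (d + 1) * b * m]. In dimension one [e]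
     is 0, and [powR] sends zero to the power zero to 1, so [N = 1] is covered too. *)
  have Xle : X <= c0 * m%:R `^ e.
    rewrite /X -mulrA ler_pM2l // ler_pdivrMl ?powR_gt0 // -powRM ?(ltW db0) //.
    apply: ge0_ler_powR => //; first by rewrite nnegrE mulr_ge0 // ltW.
    apply: le_trans (ln_le_exponent R hb N0 Nn) _.
    rewrite -!natrM ler_nat -mulnA [(b * m)%N]mulnC mulnA leq_mul2r.
    by rewrite mulnC ltnW ?orbT // ltn_ceil.
  have XQ : X <= Num.sqrt Q.
    rewrite -(ger0_norm X0) -sqrtr_sqr ler_wsqrtr //.
    apply: (@le_trans _ _ ((c0 * m%:R `^ e) ^+ 2)).
      by apply: lerXn2r => //; rewrite nnegrE // mulr_ge0 ?powR_ge0 // ltW.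
    have := sum_sqr_discr_log_ge R q hb nK N1 N2.
    rewrite -/c0 -/m.
    have -> : (c0 * m%:R `^ e) ^+ 2 = c0 ^+ 2 * m%:R ^+ d.
      rewrite [LHS]exprMn; congr (_ * _).
      by rewrite -[LHS]powR_mulrn ?powR_ge0 // -powRrM eE divfK // powR_mulrn.
    rewrite /Q natrX -exprM => /le_trans; apply; rewrite ler_pM2l ?invr_gt0 ?exprn_gt0 //.
    by apply: ler_sum => k _; rewrite qE real_normK ?num_real.
  split=> //.
  have [k hk] := @quadratic_mean_le_max R {ffun 'I_d.+1 -> 'I_(b ^ K)}
    [ffun=> Ordinal (expb_gt0 hb K)]
    (fun k => `|discrepancy (grid_point R k) P|) (fun k => normr_ge0 _).
  exists k; apply: le_trans XQ _; apply: le_trans hk.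
  by rewrite card_ffun !card_ord natrX.
have g0 := riesz_coef_gt0 R hb.
(* The bound of [discr_log_ge] is [c1 * n]; a further division by [b] passes from [n] to [ln N]. *)
pose c1 : R := riesz_coef R b / 9 / b%:R ^+ 6.
have c10 : 0 < c1 by rewrite !divr_gt0 // exprn_gt0.
exists (c1 / b%:R); split; first by rewrite divr_gt0.
move=> N nu tau M P N0 hN tau1 hM P1.
have [n [K [/andP[n0 nK] EM N1 N2]]] := scale_exponents hb N0 hN tau1 hM.
subst M; have [q qE] := discrepancy_grid K hb P1.
have [k hk] := discr_log_ge R hb q nK N1 n0 N2.
have Nn : (N <= b ^ n)%N by apply: leq_trans N1; rewrite leq_pmull // ltnW.
exists k; rewrite qE; apply: le_trans hk.
have -> : n%:R * riesz_coef R b / 9 / b%:R ^+ 6 = c1 * n%:R by rewrite /c1; ring.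
rewrite -mulrA ler_pM2l // ler_pdivrMl // mulrC; exact: ln_le_exponent.
Qed.
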